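(* Let $k\geq 2$ and let $\varphi\colon\mathcal{A}\to\mathcal{A}^*$ be a (growing) substitution of constant length $k$. Let $X_\varphi\subset\mathcal{A}^{\mathbf{N}}$ be the one-sided system generated by $\varphi$, let $Y\subset\mathcal{B}^{\mathbf{N}}$ be a one-sided subshift and let $\pi\colon X_\varphi\to Y$ be a factor map. Then: (1) A sequence $y\in Y$ is $k$-automatic if and only if $y=\pi(x)$ for some quasi-fixed point $x$ of $\varphi$. (2) If $y\in Y$ is $k$-automatic and nonperiodic, then all points in $\pi^{-1}(y)$ are quasi-fixed points of $\varphi$.
   Context: Everything here is one-sided. $\mathbf{N}=\{0,1,2,\ldots\}$. A substitution $\varphi\colon\mathcal{A}\to\mathcal{A}^*$ is growing ($|\varphi^n(a)|\to\infty$ for all $a$) and has constant length $k$ if $|\varphi(a)|=k$ for all $a$; it acts on $\mathcal{A}^{\mathbf{N}}$ by concatenation. $T$ is the one-sided shift $(Tx)_n=x_{n+1}$. $X_\varphi=\{x\in\mathcal{A}^{\mathbf{N}}:$ every finite factor of $x$ appears in $\varphi^n(a)$ for some $a\in\mathcal{A}$, $n\geq0\}$. A one-sided subshift is a closed subset $Y\subset\mathcal{B}^{\mathbf{N}}$ with $T(Y)\subset Y$; a factor map is a continuous surjection commuting with the shifts. A point $y$ is periodic if $T^py=y$ for some $p\geq1$. Convention: for $c<0$, ''$T^c(x)=y$'' means $x=T^{-c}(y)$. A point $z\in\mathcal{A}^{\mathbf{N}}$ is a quasi-fixed point of $\varphi$ if $T^c(\varphi^m(z))=z$ for some $m\geq1$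 and $c\in\mathbf{Z}$. A one-sided sequence is $k$-automatic if it is the image under a coding of a fixed point of a substitution of constant length $k$. *)

(* Defs.v *)
From mathcomp Require Import all_boot all_order all_algebra.
Set Implicit Arguments. Unset Strict Implicit. Unset Printing Implicit Defensive.

Definition const_length (A : Type) (k : nat) (phi : A -> seq A) : Prop :=
  forall a, size (phi a) = k.

Definition subst_word (A : Type) (phi : A -> seq A) (w : seq A) : seq A :=
  flatten (map phi w).
Definition subst_iter (A : Type) (phi : A -> seq A) (n : nat) (a : A) : seq A :=
  iter n (subst_word phi) [:: a].

(* Action of a substitution of constant length k on A^N by concatenation:
   phi(x) = phi(x_0) phi(x_1) ..., so phi(x)_n = phi(x_{n / k})_{n mod k}. *)
Definition subst_seq (A : Type) (k : nat) (phi : A -> seq A) (x : nat -> A)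
  : nat -> A :=
  fun n => nth (x (n %/ k)) (phi (x (n %/ k))) (n %% k).

Definition subst_seq_iter (A : Type) (k : nat) (phi : A -> seq A) (m : nat)
  (x : nat -> A) : nat -> A := iter m (subst_seq k phi) x.

Definition shiftN (A : Type) (c : nat) (x : nat -> A) : nat -> A :=
  fun n => x (n + c).

Definition factor (A : Type) (x : nat -> A) (i l : nat) : seq A :=
  mkseq (fun j => x (i + j)) l.

Definition X_subst (A : eqType) (phi : A -> seq A) (x : nat -> A) : Prop :=
  forall i l, exists a n, infix (factor x i l) (subst_iter phi n a).

(* One-sided subshift: closed (product topology, discrete alphabet) and
   shift-invariant. *)
Definition closed_seqset (B : Type) (Y : (nat -> B) -> Prop) : Prop :=
  forall y, (forall n, exists z, Y z /\ forall i, i < n -> z i = y i) -> Y y.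
Definition subshift (B : Type) (Y : (nat -> B) -> Prop) : Prop :=
  closed_seqset Y /\ forall y, Y y -> Y (shiftN 1 y).

Definition factor_map (A B : Type) (X : (nat -> A) -> Prop)
  (Y : (nat -> B) -> Prop) (pi : (nat -> A) -> (nat -> B)) : Prop :=
  [/\ forall x, X x -> Y (pi x),
      forall y, Y y -> exists2 x, X x & pi x = y,
      forall x, X x -> forall n, exists m, forall x', X x' ->
          (forall i, i < m -> x' i = x i) ->
          forall i, i < n -> pi x' i = pi x i
    & forall x, X x -> pi (shiftN 1 x) = shiftN 1 (pi x)].

Definition periodic (B : Type) (y : nat -> B) : Prop :=
  exists2 p, 0 < p & forall n, y (n + p) = y n.

(* Quasi-fixed point: T^c(phi^m(z)) = z for some m >= 1, c in Z, with the
   convention that for c < 0 this means z = ... i.e. phi^m(z) = T^{-c}(z). *)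
Definition quasi_fixed (A : Type) (k : nat) (phi : A -> seq A) (z : nat -> A)
  : Prop :=
  exists2 m, 0 < m &
    exists c : int,
      match c with
      | Posz c' => forall n, shiftN c' (subst_seq_iter k phi m z) n = z n
      | Negz c' => forall n, subst_seq_iter k phi m z n = shiftN c'.+1 z n
      end.

Definition automatic (B : Type) (k : nat) (y : nat -> B) : Prop :=
  exists (C : finType) (psi : C -> seq C) (tau : C -> B) (u : nat -> C),
    [/\ const_length k psi,
        forall n, subst_seq k psi u n = u n
      & forall n, y n = tau (u n)].

(* Main.v *)
Require Import Defs.
From mathcomp Require Import all_boot all_order all_algebra.
From mathcomp Require Import boolp zify.
Set Implicit Arguments. Unset Strict Implicit. Unset Printing Implicit Defensive.

(** Desubstitute a point of the fiber over [y] as [x = T^{c_n}(phi^n(x_n))] with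
    [x_n] in [X_phi] and [c_n < k^n], so that [y = T^{c_n}(F_n(x_n))] where
    [F_n = pi o phi^n].  The [k^n]-blocks of [F_n(v)] depend on windows of [v] of a
    fixed length [W], whereas the [k^n]-blocks of an automatic [y] depend on the
    letters of a fixed sequence [u] which does not depend on [n].  Hence the
    sequences [v] with [y = T^c(F_n(v))] for some [c < k^n] have finitely many
    "types", uniformly in [n], and equality of types forces [F_n(v) = F_n(w)].

    If [x_a] and [x_{a'}], [a < a'], have the same type and
    [x_a = T^c(phi^{a'-a}(x_{a'}))], the map [S = T^c o phi^{a'-a}] preserves the
    fiber of [F_a] through [x_a]; the iterates of [S] at [x_a]
    accumulate at a point fixed by a power of [S], which yields a quasi-fixed point
    over [y].  If [y] is moreover nonperiodic, [F_n(v) = F_n(w)] forces equal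
    offsets for [v] and [w] over [y], and a second use of the pigeonhole principle
    shows that the sequence [x_n] itself repeats. *)

(** * Pigeonhole and choice principles *)

Lemma infinite_pigeonhole (T : finType) (f : nat -> T) :
  exists t, forall N, exists2 n, N <= n & f n = t.
Proof.
apply: contrapT => H.
have /fin_all_exists [g Hg] (t : T) : exists N, forall n, N <= n -> f n <> t.
  apply: contrapT => Ht; apply: H; exists t => N.
  apply: contrapT => HN; apply: Ht; exists N => n Nn fn.
  by apply: HN; exists n.
exact: (Hg (f (\max_t g t)) _ (leq_bigmax _)).
Qed.

Lemma infinite_enumeration (P : nat -> Prop) :
  (forall N, exists2 n, N <= n & P n) ->
  exists e : nat -> nat, (forall i, P (e i)) /\ {homo e : i j / i < j}.
Proof.
move=> H.
have /choice [h Hh] N : exists n, N <= n /\ P n.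
  by have [n] := H N; exists n.
exists (fix e i := if i is j.+1 then h (e j).+1 else h 0); split.
  by case=> [|i]; apply: (Hh _).2.
by apply: homo_ltn => [? ? ?|i]; [apply: ltn_trans | apply: (Hh _).1].
Qed.

(** At each [n] two of the first [#|T|.+1] indices collide; such pairs are finite in number, so one
    of them recurs for infinitely many [n]. *)
Lemma pair_pigeonhole (T : finType) (f : nat -> nat -> T) :
  exists i j, i < j /\ forall N, exists2 n, N <= n & f i n = f j n.
Proof.
set M := #|T|.+1.
have /choice [g Hg] n : exists p : 'I_M * 'I_M, p.1 < p.2 /\ f p.1 n = f p.2 n.
  have /injectivePn [i [j ij fij]] : ~~ injectiveb (fun i : 'I_M => f i n).
    apply/negP => /injectiveP /leq_card; rewrite card_ord ltnn //.
  case: (ltngtP i j) => h; [by exists (i, j)|by exists (j, i)|].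
  by case/eqP: ij; apply: val_inj.
have [[i j] H] := infinite_pigeonhole g.
exists i, j; split=> [|N]; last first.
  by have [n Nn gn] := H N; exists n => //; have := (Hg n).2; rewrite gn.
by have [n _ gn] := H 0; have := (Hg n).1; rewrite gn.
Qed.

Lemma dependent_choice (T : Type) (P : nat -> T -> Prop)
    (R : nat -> T -> T -> Prop) (x0 : T) :
  P 0 x0 -> (forall n x, P n x -> exists2 x', R n x x' & P n.+1 x') ->
  exists f : nat -> T,
    f 0 = x0 /\ forall n, P n (f n) /\ R n (f n) (f n.+1).
Proof.
move=> P0 H.
have /choice [g Hg] (p : nat * T) :
    exists x', P p.1 p.2 -> R p.1 p.2 x' /\ P p.1.+1 x'.
  case: (pselect (P p.1 p.2)) => [/H [x' Rx Px]|nP]; first by exists x'.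
  by exists p.2.
pose f := fix f n := if n is m.+1 then g (m, f m) else x0.
have Pf n : P n (f n) by elim: n => [//|n IH]; apply: (Hg (n, f n) IH).2.
by exists f; split=> // n; split=> //; exact: (Hg (n, f n) (Pf n)).1.
Qed.

(** * Agreement of prefixes and compactness *)

Definition agree (A : Type) (N : nat) (v w : nat -> A) : Prop :=
  forall i, i < N -> v i = w i.

Lemma agree_sym (A : Type) N (v w : nat -> A) : agree N v w -> agree N w v.
Proof. by move=> H i /H. Qed.

Lemma agree_trans (A : Type) N (w v z : nat -> A) :
  agree N v w -> agree N w z -> agree N v z.
Proof. by move=> H H' i iN; rewrite H // H'. Qed.

Lemma agree_le (A : Type) M N (v w : nat -> A) :
  agree N v w -> M <= N -> agree M v w.
Proof. by move=> H MN i iM; apply: H; apply: leq_trans MN. Qed.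

Lemma agree_eq (A : Type) (v w : nat -> A) : (forall N, agree N v w) -> v = w.
Proof. by move=> H; apply: funext => i; exact: (H i.+1). Qed.

Lemma seq_compact (A : finType) (s : nat -> nat -> A) :
  exists x, forall N M, exists2 l, M <= l & agree N (s l) x.
Proof.
(* Invariant of the refinement: infinitely many terms of [s] start with the first [n] letters of
   [z]. The limit is read along the diagonal. *)
pose P n (z : nat -> A) := forall M, exists2 l, M <= l & agree n (s l) z.
have P0 : P 0 (s 0) by move=> M; exists M.
have step n z : P n z -> exists2 z', agree n z' z & P n.+1 z'.
  move=> /infinite_enumeration [e [Pe lte]].
  have [a Ha] := infinite_pigeonhole (fun i => s (e i) n).
  have [i0 _ ai0] := Ha 0.
  exists (s (e i0)); first exact: Pe.
  move=> M; have [i Mi ai] := Ha M; exists (e i).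
    apply: leq_trans Mi _; elim: i {ai} => // i IH.
    exact: leq_ltn_trans IH (lte _ _ _).
  move=> j; rewrite ltnS leq_eqVlt => /predU1P[->|jn]; first by rewrite ai.
  by rewrite Pe // Pe.
have [f [_ Hf]] := dependent_choice P0 step.
have fD n m : agree n (f (n + m)) (f n).
  elim: m => [|m IH]; first by rewrite addn0.
  rewrite addnS; apply: agree_trans IH.
  have Hnm : agree (n + m) (f (n + m).+1) (f (n + m)) := (Hf (n + m)).2.
  by apply: agree_le Hnm _; rewrite leq_addr.
exists (fun n => f n.+1 n) => N M.
have [l Ml Hl] := (Hf N).1 M; exists l => // i iN.
by rewrite Hl // -(fD i.+1 (N - i.+1)) // subnKC.
Qed.

(** * Substitutions acting on sequences, and their expansion *)

Section Substitution.
Variables (A : Type) (k : nat) (phi : A -> seq A).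
Hypothesis k_gt0 : 0 < k.

Lemma expk_gt0 m : 0 < k ^ m. Proof. by rewrite expn_gt0 k_gt0. Qed.

Lemma subst_seqE v j i :
  i < k -> subst_seq k phi v (k * j + i) = nth (v j) (phi (v j)) i.
Proof.
by move=> ik; rewrite /subst_seq mulnC divnMDl // divn_small // addn0 modnMDl modn_small.
Qed.

Lemma subst_seq_iterS m v :
  subst_seq_iter k phi m.+1 v = subst_seq k phi (subst_seq_iter k phi m v).
Proof. by []. Qed.

(** Allowing [j] and [j'] to differ yields both the commutation with shifts and the block structure
    of fixed points. *)
Lemma subst_seq_iter_local m v w j j' i :
  v j = w j' -> i < k ^ m ->
  subst_seq_iter k phi m v (k ^ m * j + i)
    = subst_seq_iter k phi m w (k ^ m * j' + i).
Proof.
move=> vw; elim: m i => [|m IH] i.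
  by rewrite expn0 ltnS leqn0 => /eqP ->; rewrite !mul1n !addn0.
rewrite expnS => ikm.
have ik : i %/ k < k ^ m by rewrite ltn_divLR // mulnC.
have E t : k * k ^ m * t + i = k * (k ^ m * t + i %/ k) + i %% k.
  by rewrite [in LHS](divn_eq i k); lia.
by rewrite !E !subst_seq_iterS !subst_seqE ?ltn_pmod // IH.
Qed.

Lemma shiftN0 (v : nat -> A) : shiftN 0 v = v.
Proof. by apply: funext => i; rewrite /shiftN addn0. Qed.

Lemma shiftN_add a b (v : nat -> A) : shiftN a (shiftN b v) = shiftN (a + b) v.
Proof. by apply: funext => i; rewrite /shiftN addnA. Qed.

Lemma subst_seq_iter_shift m c v :
  subst_seq_iter k phi m (shiftN c v)
    = shiftN (k ^ m * c) (subst_seq_iter k phi m v).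
Proof.
apply: funext => i; rewrite /shiftN (divn_eq i (k ^ m)).
rewrite mulnC addnAC -mulnDr; apply: subst_seq_iter_local => //.
by rewrite ltn_pmod ?expk_gt0.
Qed.

Lemma subst_seq_iter_agree m L v w :
  agree L v w ->
  agree (k ^ m * L) (subst_seq_iter k phi m v) (subst_seq_iter k phi m w).
Proof.
move=> vw i iL; rewrite (divn_eq i (k ^ m)) mulnC.
apply: subst_seq_iter_local; last by rewrite ltn_pmod ?expk_gt0.
by apply: vw; rewrite ltn_divLR ?expk_gt0 // mulnC.
Qed.

Definition unfold_at (c m : nat) (v : nat -> A) : nat -> A :=
  shiftN c (subst_seq_iter k phi m v).

(** Since [phi^m o T^c = T^(k^m c) o phi^m], offsets compose like base [k] expansions. *)
Lemma unfold_at_comp c m c' m' v :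
  unfold_at c m (unfold_at c' m' v) = unfold_at (c + k ^ m * c') (m + m') v.
Proof.
by rewrite /unfold_at subst_seq_iter_shift shiftN_add /subst_seq_iter iterD.
Qed.

Lemma unfold_at_agree c m L v w :
  agree L v w -> agree (k ^ m * L - c) (unfold_at c m v) (unfold_at c m w).
Proof.
by move=> /(@subst_seq_iter_agree m) vw i iL; apply: vw; lia.
Qed.

Lemma iter_unfold_at c m q v : exists c',
  iter q (unfold_at c m) v = unfold_at c' (m * q) v.
Proof.
elim: q => [|q [c' IH]].
  by exists 0; rewrite muln0 /unfold_at shiftN0.
by exists (c + k ^ m * c'); rewrite iterS IH unfold_at_comp mulnS.
Qed.

(* Both [phi^p(x)] and [x] are shifts of [phi^(a+p)(w)]. *)
Lemma quasi_fixed_unfold_at a b c p w :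
  0 < p -> unfold_at c p w = w -> quasi_fixed k phi (unfold_at b a w).
Proof.
move=> p_gt0 wE; set V := subst_seq_iter k phi (a + p) w.
have xE : unfold_at b a w = shiftN (b + k ^ a * c) V.
  by rewrite -[in LHS]wE unfold_at_comp.
have pxE : subst_seq_iter k phi p (unfold_at b a w) = shiftN (k ^ p * b) V.
  by rewrite /unfold_at subst_seq_iter_shift /V addnC /subst_seq_iter iterD.
exists p => //; rewrite pxE xE.
case: (leqP (k ^ p * b) (b + k ^ a * c)) => h.
  by exists (Posz (b + k ^ a * c - k ^ p * b)) => n; rewrite shiftN_add subnK.
exists (Negz (k ^ p * b - (b + k ^ a * c)).-1) => n.
by rewrite shiftN_add prednK ?subn_gt0 // subnK // ltnW.
Qed.

End Substitution.

(** As [c <= k^m - 1] and [k^m, L >= 2], one has [k^m L - c >= k^m (L - 1) + 1 >= 2 L - 1 >= L +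
    1]. *)
Lemma unfold_at_agreeS (A : Type) k (phi : A -> seq A) c m L v w :
  1 < k -> 0 < m -> c < k ^ m -> 1 < L -> agree L v w ->
  agree L.+1 (unfold_at k phi c m v) (unfold_at k phi c m w).
Proof.
move=> k_gt1 m_gt0 cm L_gt1 vw.
have := @unfold_at_agree _ k phi (ltnW k_gt1) c m _ _ _ vw; move/agree_le; apply.
have : 1 < k ^ m by rewrite -(exp1n m) ltn_exp2r.
nia.
Qed.

Lemma iter_unfold_at_agree (A : Type) k (phi : A -> seq A) c m t L v w :
  1 < k -> 0 < m -> c < k ^ m -> 1 < L -> agree L v w ->
  agree (L + t) (iter t (unfold_at k phi c m) v) (iter t (unfold_at k phi c m) w).
Proof.
move=> k_gt1 m_gt0 cm L_gt1 vw; elim: t => [|t IH]; first by rewrite addn0.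
by rewrite addnS !iterS; apply: unfold_at_agreeS => //; rewrite ltn_addr.
Qed.

(** Two iterates at distance [q] share their first two letters; expansion then makes the iterates of
    [S^q] converge, to a point fixed by [S^q]. *)
Lemma unfold_at_periodic_limit (A : finType) k (phi : A -> seq A) c m
    (v : nat -> A) :
  1 < k -> 0 < m -> c < k ^ m ->
  exists q w, [/\ 0 < q, iter q (unfold_at k phi c m) w = w
    & forall N, exists i, agree N w (iter i (unfold_at k phi c m) v)].
Proof.
move=> k_gt1 m_gt0 cm; set S := unfold_at k phi c m.
have [p Hp] := infinite_pigeonhole (fun i => (iter i S v 0, iter i S v 1)).
have [i _ pi] := Hp 0; have [j ij pj] := Hp i.+1.
set q := j - i; set v0 := iter i S v.
have q_gt0 : 0 < q by rewrite subn_gt0.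
have S_agree t L x x' : 1 < L -> agree L x x' ->
    agree (L + t) (iter t S x) (iter t S x') by exact: iter_unfold_at_agree.
pose V t := iter (t * q) S v0.
have V_agree t : agree t.+2 (V t) (V t.+1).
  have vq : agree 2 v0 (iter q S v0).
    rewrite /v0 -iterD subnK 1?ltnW // -pj in pi *.
    by case: pi => e0 e1 [|[|]] //.
  rewrite /V mulSn addnC iterD.
  by apply: agree_le (S_agree _ 2 _ _ _ vq) _ => //; nia.
have V_le s t : s <= t -> agree s.+2 (V s) (V t).
  move=> /subnKC <-; elim: (t - s) => [|r IH]; first by rewrite addn0.
  rewrite addnS; apply: agree_trans IH _.
  by apply: agree_le (V_agree _) _; rewrite !ltnS leq_addr.
(* Letter [n] no longer changes from [V n] on, so the diagonal is the limit. *)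
exists q, (fun n => V n n).
have wV t : agree t.+2 (fun n => V n n) (V t).
  move=> n nt; case: (leqP n t) => h; first by apply: (V_le n t).
  by apply/esym/(V_le t n); rewrite ?(ltnW h).
split=> //; last by move=> N; exists (N * q + i); rewrite iterD; apply: agree_le (wV N) _; lia.
apply: agree_eq => N; apply: agree_trans (agree_le (agree_sym (wV N.+1)) _); last lia.
rewrite /V mulSn iterD; apply: agree_le (S_agree q N.+2 _ _ _ (wV N)) _ => //; lia.
Qed.

(** * The system generated by the substitution, and desubstitution *)

Lemma X_substP (A : eqType) (phi : A -> seq A) x : X_subst phi x <->
  forall N, exists a n p, p + N <= size (subst_iter phi n a) /\
    forall t, t < N -> x t = nth a (subst_iter phi n a) (p + t).
Proof.
split=> [Xx N|Xx i l].
  have [a [n /infixP [s [s' E]]]] := Xx 0 N; exists a, n, (size s).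
  rewrite E !size_cat size_mkseq addnA; split=> [|t tN]; first exact: leq_addr.
  by rewrite nth_cat ltnNge leq_addr /= addKn nth_cat size_mkseq tN nth_mkseq.
have [a [n [p [pN xE]]]] := Xx (i + l); exists a, n.
set w := subst_iter phi n a in pN xE *.
apply/infixP; exists (take (p + i) w), (drop l (drop (p + i) w)).
rewrite -[LHS](cat_take_drop (p + i)) -[X in _ ++ X = _](cat_take_drop l).
congr (_ ++ (_ ++ _)); apply: (@eq_from_nth _ a) => [|t].
  by rewrite size_mkseq size_take size_drop; case: ifP; lia.
rewrite size_take size_drop => tl; have {}tl : t < l by move: tl; case: ifP; lia.
rewrite nth_take // nth_drop nth_mkseq // xE ?addnA //; lia.
Qed.

Lemma X_subst_closed (A : eqType) (phi : A -> seq A) x :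
  (forall N, exists2 x', X_subst phi x' & agree N x' x) -> X_subst phi x.
Proof.
move=> H; apply/X_substP => N; have [x' /X_substP Xx' x'x] := H N.
have [a [n [p [pN E]]]] := Xx' N; exists a, n, p; split=> // t tN.
by rewrite -x'x // E.
Qed.

Lemma X_subst_shift (A : eqType) (phi : A -> seq A) c x :
  X_subst phi x -> X_subst phi (shiftN c x).
Proof.
move=> /X_substP Xx; apply/X_substP => N.
have [a [n [p [pN E]]]] := Xx (c + N); exists a, n, (p + c).
split=> [|t tN]; first lia.
rewrite /shiftN E; [congr nth|]; lia.
Qed.

(** Base [k] number with least significant digit [d 0]: the offset accumulated over [m]
    desubstitutions. *)
Fixpoint digits_value (k : nat) (d : nat -> nat) (m : nat) : nat :=
  if m is m'.+1 then digits_value k d m' + k ^ m' * d m' else 0.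

Lemma digits_value_lt k d m : (forall n, d n < k) -> digits_value k d m < k ^ m.
Proof.
by move=> dk; elim: m => //= m IH; rewrite expnS; have := dk m; nia.
Qed.

Lemma digits_valueD k d m m' :
  digits_value k d (m + m')
    = digits_value k d m + k ^ m * digits_value k (fun i => d (m + i)) m'.
Proof.
elim: m' => [|m' IH]; first by rewrite addn0 muln0 addn0.
by rewrite addnS /= IH expnD; lia.
Qed.

Section System.
Variables (A : finType) (k : nat) (phi : A -> seq A).
Hypotheses (k_gt1 : 1 < k) (phi_k : const_length k phi).

Let k_gt0 : 0 < k := ltnW k_gt1.

Lemma size_subst_word w : size (subst_word phi w) = k * size w.
Proof.
elim: w => [|a w IH]; first by rewrite muln0.
by rewrite /subst_word /= size_cat phi_k -/(subst_word phi w) IH mulnS.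
Qed.

Lemma nth_subst_word a w j i : j < size w -> i < k ->
  nth a (subst_word phi w) (k * j + i) = nth a (phi (nth a w j)) i.
Proof.
move=> + ik; elim: w j => [//|b w IH] [|j] jw.
  by rewrite muln0 add0n /subst_word /= nth_cat phi_k ik.
rewrite mulnS -addnA /subst_word /= nth_cat phi_k.
by rewrite ltnNge leq_addr /= addKn IH.
Qed.

Lemma nth_subst_word_window a w p N v :
  p + N <= size w -> (forall t, t < N -> v t = nth a w (p + t)) ->
  forall t, t < k * N ->
    subst_seq k phi v t = nth a (subst_word phi w) (k * p + t).
Proof.
move=> pN vE t tN; have q_lt : t %/ k < N by rewrite ltn_divLR // mulnC.
have -> : k * p + t = k * (p + t %/ k) + t %% k by rewrite [in LHS](divn_eq t k); lia.
rewrite [in LHS](divn_eq t k) mulnC subst_seqE ?ltn_pmod //.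
rewrite nth_subst_word ?ltn_pmod //; last by lia.
by rewrite vE //; apply: set_nth_default; rewrite phi_k ltn_pmod.
Qed.

Lemma X_subst_subst_seq x : X_subst phi x -> X_subst phi (subst_seq k phi x).
Proof.
move=> /X_substP Xx; apply/X_substP => N.
have [a [n [p [pN E]]]] := Xx N; exists a, n.+1, (k * p).
rewrite /subst_iter iterS size_subst_word -/(subst_iter phi n a).
split=> [|t tN].
  by apply: leq_trans (leq_mul (leqnn k) pN); rewrite mulnDr leq_add2l leq_pmull.
by apply: nth_subst_word_window E _ _ => //; apply: leq_trans tN (leq_pmull _ _).
Qed.

Lemma X_subst_unfold_at c m x :
  X_subst phi x -> X_subst phi (unfold_at k phi c m x).
Proof.
move=> Xx; apply: X_subst_shift; elim: m => // m IH.
by rewrite subst_seq_iterS; apply: X_subst_subst_seq.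
Qed.

(** Long prefixes of [x] occur in words [phi(w)], [w = phi^n(a)], at some position [p]: [p %% k] is
    the offset, and [w] read from [p %/ k] is a partial preimage. Compactness passes to the
    limit. *)
Lemma X_subst_desubstitute x : X_subst phi x ->
  exists d x', [/\ d < k, X_subst phi x' & x = unfold_at k phi d 1 x'].
Proof.
move=> /X_substP Xx.
have /choice [s Hs] l : exists s : (nat -> A) * 'I_k,
    (exists a n p, forall N, k * N <= l ->
      p + N <= size (subst_iter phi n a) /\
      forall t, t < N -> s.1 t = nth a (subst_iter phi n a) (p + t)) /\
    agree l x (unfold_at k phi s.2 1 s.1).
  (* At least two letters are taken, so that the prefix cannot lie in [phi^0(a)], of size 1. *)
  have [a [n [p [pl xE]]]] := Xx l.+2.
  case: n => [|n] in pl xE; first by rewrite /= in pl; lia.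
  rewrite /subst_iter iterS -/(subst_iter phi n a) size_subst_word in pl xE.
  set w := subst_iter phi n a in pl xE.
  exists (fun t => nth a w (p %/ k + t), Ordinal (ltn_pmod p k_gt0)); split.
    exists a, n, (p %/ k) => N kN; split=> //.
    have : k * (p %/ k + N) <= k * size w; last by rewrite leq_pmul2l.
    by have := leq_trunc_div p k; nia.
  move=> i il; rewrite xE ?ltnS ?(ltnW il) ?leqW //=; last by rewrite ltnW.
  rewrite /unfold_at /shiftN subst_seq_iterS /subst_seq_iter /=.
  rewrite [in LHS](divn_eq (p + i) k) (mulnC _ k).
  have pi_lt : (p + i) %/ k < size w by rewrite ltn_divLR // mulnC; lia.
  have -> : i + p %% k = k * ((p + i) %/ k - p %/ k) + (p + i) %% k.
    have := divn_eq p k; have := divn_eq (p + i) k.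
    have := leq_div2r k (leq_addr i p); nia.
  rewrite nth_subst_word ?ltn_pmod // subst_seqE ?ltn_pmod //.
  rewrite subnKC ?leq_div2r ?leq_addr //.
  by apply: set_nth_default; rewrite phi_k ltn_pmod.
(* The offset is attached to every letter, so that one extraction handles both limits. *)
have [z Hz] := seq_compact (fun l i => ((s l).1 i, (s l).2)).
pose x' i := (z i).1; pose d := (z 0).2.
have Hl N M : exists l, [/\ M <= l, agree N (s l).1 x' & (s l).2 = d].
  have [l Ml sz] := Hz N.+1 M; exists l; split=> // [i iN|].
    by rewrite /x' -sz // ltnW.
  by rewrite /d -sz.
exists d, x'; split=> //.
  apply/X_substP => N; have [l [Nl sx' _]] := Hl N (k * N).
  have [[a [n [p /(_ N Nl) [pN E]]]] _] := Hs l; exists a, n, p; split=> // t tN.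
  by rewrite -sx' // E.
apply: agree_eq => N; have [l [Nl sx' sd]] := Hl N.+1 N.
have [_] := Hs l; rewrite sd => /agree_le /(_ Nl) xs; apply: agree_trans xs _.
have := @unfold_at_agree _ k phi k_gt0 d 1 _ _ _ sx'; move/agree_le; apply.
by have := ltn_ord d; rewrite expn1; nia.
Qed.

Definition chain (v : nat -> nat -> A) (d : nat -> nat) : Prop :=
  forall n, [/\ X_subst phi (v n), d n < k
              & v n = unfold_at k phi (d n) 1 (v n.+1)].

Lemma X_subst_chain x : X_subst phi x -> exists v d, chain v d /\ v 0 = x.
Proof.
move=> Xx.
have [] := @dependent_choice (nat -> A) (fun _ v => X_subst phi v)
  (fun _ v v' => exists2 d, d < k & v = unfold_at k phi d 1 v') x Xx.
  by move=> _ z /X_subst_desubstitute [d [z' [? ? ?]]]; exists z' => //; exists d.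
move=> v [v0 Hv].
have /choice [d Hd] n : exists d, d < k /\ v n = unfold_at k phi d 1 (v n.+1).
  by have [_ [d ? ?]] := Hv n; exists d.
by exists v, d; split=> // n; have [? _] := Hv n; have [] := Hd n.
Qed.

Lemma chain_shift v d a :
  chain v d -> chain (fun i => v (a + i)) (fun i => d (a + i)).
Proof. by move=> H n; have := H (a + n); rewrite addnS. Qed.

Lemma chain_unfold v d m :
  chain v d -> v 0 = unfold_at k phi (digits_value k d m) m (v m).
Proof.
move=> H; elim: m => [|m IH]; first by rewrite /unfold_at shiftN0.
have [_ _ E] := H m; rewrite [LHS]IH E unfold_at_comp //.
by rewrite addn1.
Qed.

End System.

(** * Automatic sequences: kernels and blocks *)

Lemma automatic_of_kernel (B : finType) k (I : finType) (f : I -> nat -> B) :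
  0 < k ->
  (forall i r, r < k -> exists j, forall n, f i (k * n + r) = f j n) ->
  forall i, automatic k (f i).
Proof.
move=> k_gt0 H i0.
pose next i r := odflt i [pick j | `[< forall n, f i (k * n + r) = f j n >]].
have nextE i r n : r < k -> f i (k * n + r) = f (next i r) n.
  move=> rk; rewrite /next; case: pickP => [j /asboolP -> //|/= N].
  by have [j /asboolP Hj] := H i r rk; have := N j; rewrite Hj.
(* A letter stores the values of all the [f i] at one position [n]; its image lists those at the
   positions [k n + r]. *)
pose psi (c : {ffun I -> B}) := mkseq (fun r => [ffun i => c (next i r)]) k.
exists {ffun I -> B}, psi, (fun c : {ffun I -> B} => c i0), (fun n => [ffun i => f i n]).
split=> [c|n|n]; rewrite ?size_mkseq ?ffunE //.
rewrite /subst_seq nth_mkseq ?ltn_pmod //; apply/ffunP => i; rewrite !ffunE.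
by rewrite -nextE ?ltn_pmod // mulnC -divn_eq.
Qed.

Lemma automatic_of_power_kernel (B : finType) k m (I : finType)
    (f : I -> nat -> B) :
  0 < k -> 0 < m ->
  (forall i r, r < k ^ m -> exists j, forall n, f i (k ^ m * n + r) = f j n) ->
  forall i, automatic k (f i).
Proof.
case: m => // m k_gt0 _ H i0; set K := k ^ m.+1 in H *.
have K_gt0 : 0 < K by rewrite expn_gt0 k_gt0.
have le_K j : j <= m.+1 -> k ^ j <= K by move=> jm; rewrite leq_pexp2l.
(* The intermediate decimations join the family. Reducing the residue modulo [k^j] lets the single
   type ['I_K] serve all exponents. *)
pose F (t : I * 'I_m.+1 * 'I_K) n :=
  f t.1.1 (k ^ t.1.2 * n + t.2 %% k ^ t.1.2).
have -> : f i0 = F (i0, ord0, Ordinal K_gt0).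
  by apply: funext => n; rewrite /F /= expn0 mul1n mod0n addn0.
apply: automatic_of_kernel => // -[[i j] r] s sk.
set r' := k ^ j * s + r %% k ^ j.
have r'_lt : r' < k ^ j.+1.
  have : r %% k ^ j < k ^ j by rewrite ltn_pmod // expn_gt0 k_gt0.
  by rewrite expnS /r'; nia.
have r'_K : r' < K := leq_trans r'_lt (le_K _ (ltn_ord j)).
have E n : F (i, j, r) (k * n + s) = f i (k ^ j.+1 * n + r').
  by rewrite /F /r' /= expnS; congr f; lia.
have [jm|] := ltnP j.+1 m.+1.
  exists (i, Ordinal jm, Ordinal r'_K) => n; rewrite E.
  by rewrite /F [_.1.2]/= [nat_of_ord _]/= modn_small.
move=> mj; have jm : j.+1 = m.+1 by have := ltn_ord j; lia.
have [i' Hi'] := H i r' r'_K.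
exists (i', ord0, Ordinal K_gt0) => n.
by rewrite E jm -/K Hi' /F /= expn0 mul1n mod0n addn0.
Qed.

(** As [u] is fixed by every [psi^n], its block of length [k^n] at [j] is [psi^n(u_j)]. *)
Lemma automatic_blocks (B : Type) k (y : nat -> B) :
  0 < k -> automatic k y ->
  exists (C : finType) (u : nat -> C), forall n j j' i,
    i < k ^ n -> u j = u j' -> y (k ^ n * j + i) = y (k ^ n * j' + i).
Proof.
move=> k_gt0 [C [psi [tau [u [_ uE yE]]]]]; exists C, u => n j j' i ikn ujj.
have uE' m : subst_seq_iter k psi m u = u.
  by elim: m => // m IH; rewrite subst_seq_iterS IH; apply: funext.
by rewrite !yE -(uE' n); congr tau; apply: subst_seq_iter_local.
Qed.

(* A sequence eventually given by a sliding block code of [x], with windows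
   [x_{n-J} ... x_{n+J'}]: [J] and [J'] are taken large enough for the decimations
   of such a sequence to be of the same kind. *)
Lemma automatic_of_quasi_fixed (A B : finType) k (phi : A -> seq A) x W
    (y : nat -> B) :
  1 < k -> quasi_fixed k phi x ->
  (forall n n', agree W (shiftN n x) (shiftN n' x) -> y n = y n') ->
  automatic k y.
Proof.
move=> k_gt1 [m m_gt0 [c cE]] yE; have k_gt0 := ltnW k_gt1.
(* Both signs of [c] are merged into one relation, where [a] or [b] is zero. *)
have {c cE} [a [b xE]] : exists a b, forall n, x (n + b) = subst_seq_iter k phi m x (n + a).
  case: c cE => c cE; first by exists c, 0 => n; rewrite addn0 -cE.
  by exists 0, c.+1 => n; rewrite addn0 cE.
set K := k ^ m in xE *; have K_gt1 : 1 < K by rewrite -(exp1n m) ltn_exp2r.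
have K_gt0 := ltnW K_gt1.
(* The window of a decimation, pulled back through [phi^m], must stay inside the window of the same
   shape: on the left by [K J >= J + b], on the right by [K (a + W) >= 2 (a + W)]. *)
pose J := b; pose L := J + (a + W).+1; pose N := J + b.
pose good (h : nat -> B) := forall n n', N <= n -> N <= n' ->
  agree L (shiftN (n - J) x) (shiftN (n' - J) x) -> h n = h n'.
have good_y : good y.
  move=> n n' Nn Nn' nn'; apply: yE => i iW.
  by have := nn' (i + J); rewrite /shiftN -!addnA !subnKC; [apply; lia|lia|lia].
have good_dec h r : r < K -> good h -> good (fun n => h (K * n + r)).
  have KJ : J + b <= K * J by rewrite addnn -mul2n leq_mul2r K_gt1 orbT.
  move=> rK gh n n' Nn Nn' nn'; apply: gh => [||i iL].
  - by rewrite (leq_trans Nn) // (leq_trans (leq_pmull n K_gt0)) ?leq_addr.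
  - by rewrite (leq_trans Nn') // (leq_trans (leq_pmull n' K_gt0)) ?leq_addr.
  set z := i + r + K * J + a - J - b.
  have shiftE l : N <= l -> exists2 s, i + (K * l + r - J) = s + b &
      s + a = K * (l - J + z %/ K) + z %% K.
    move=> Nl; exists (K * (l - J) + (i + r + K * J - J - b)).
      have -> : K * l = K * (l - J) + K * J.
        by rewrite -mulnDr subnK // (leq_trans _ Nl) // leq_addr.
      move: (K * J) (K * (l - J)) KJ => KJ Kl; lia.
    rewrite [in RHS]mulnDr -[RHS]addnA (mulnC K (z %/ K)) -divn_eq /z.
    move: (K * J) (K * (l - J)) KJ => KJ Kl; lia.
  have [s Es Es'] := shiftE n Nn; have [s' Et Et'] := shiftE n' Nn'.
  rewrite /shiftN Es Et !xE Es' Et'; apply: subst_seq_iter_local => //.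
    have := nn' (z %/ K); rewrite /shiftN !(addnC _ (_ - J)); apply.
    rewrite ltn_divLR // mulnC /L mulnDr mulnS.
    have : 2 * (a + W) <= K * (a + W) by rewrite leq_mul2r K_gt1 orbT.
    move: iL KJ; rewrite /z /L; move: (K * J) (K * (a + W)) => KJ Kw; lia.
  by rewrite ltn_pmod.
pose win n := [ffun i : 'I_L => shiftN (n - J) x i].
(* A good sequence is given by a table on windows and its first [N] values, so [f] indexes all of
   them by a finite type. *)
pose f (t : {ffun {ffun 'I_L -> A} -> B} * {ffun 'I_N -> B}) n :=
  if insub n is Some i then t.2 i else t.1 (win n).
have good_f t : good (f t).
  move=> n n' Nn Nn' nn'; rewrite /f !insubF ?ltnNge ?Nn ?Nn' //; congr (t.1 _).
  by apply/ffunP => i; rewrite !ffunE nn'.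
have f_good h : good h -> exists t, forall n, f t n = h n.
  move=> gh.
  have /fin_all_exists [g gE] (p : {ffun 'I_L -> A}) :
      exists b0, forall n, N <= n -> win n = p -> h n = b0.
    case: (pselect (exists2 n, N <= n & win n = p)) => [[n Nn wn]|np].
      exists (h n) => n' Nn' wn'; apply: gh => // i iL.
      by have /ffunP /(_ (Ordinal iL)) := etrans wn' (esym wn); rewrite !ffunE.
    by exists (h 0) => n Nn wn; case: np; exists n.
  exists ([ffun p => g p], [ffun i : 'I_N => h i]) => n; rewrite /f.
  case: insubP => [i _ <-|]; first by rewrite ffunE.
  by rewrite -leqNgt => Nn; rewrite ffunE -(gE _ n).
have [t ft] := f_good y good_y; rewrite -(funext ft).
apply: (@automatic_of_power_kernel B k m) => // i r rK.
have [j fj] := f_good _ (good_dec _ r rK (good_f i)).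
by exists j => n; rewrite fj.
Qed.

(** * Factor maps, their windows and their levels *)

Section Factor.
Variables (A B : finType) (k : nat) (phi : A -> seq A).
Variables (Y : (nat -> B) -> Prop) (pi : (nat -> A) -> (nat -> B)).
Hypotheses (k_gt1 : 1 < k) (phi_k : const_length k phi).
Hypothesis pi_factor : factor_map (X_subst phi) Y pi.

Let k_gt0 : 0 < k := ltnW k_gt1.
Notation X := (X_subst phi).
Notation phi_ m := (subst_seq_iter k phi m).
Notation unfold := (unfold_at k phi).

Lemma factor_map_shift c x : X x -> pi (shiftN c x) = shiftN c (pi x).
Proof.
case: pi_factor => _ _ _ pi1 Xx; elim: c => [|c IH].
  by rewrite !shiftN0.
rewrite -add1n -shiftN_add pi1; last exact: X_subst_shift.
by rewrite IH shiftN_add.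
Qed.

(** Compactness: pairs violating every [W] would accumulate at a point where [pi] is not continuous.
    The bound [1 < W] makes [k^m W - c] tend to infinity with [m] whenever [c < k^m]. *)
Lemma factor_map_window : exists W, 1 < W /\
  forall x x', X x -> X x' -> agree W x x' -> pi x 0 = pi x' 0.
Proof.
apply: contrapT => H.
have /choice [s Hs] W : exists p : (nat -> A) * (nat -> A),
    [/\ X p.1, X p.2, agree W p.1 p.2 & pi p.1 0 <> pi p.2 0].
  apply: contrapT => HW; apply: H; exists W.+2; split=> // x x' Xx Xx' xx'.
  apply: contrapT => ne; apply: HW; exists (x, x'); split=> //.
  by apply: agree_le xx' _; rewrite -addn2 leq_addr.
have [x Hx] := seq_compact (fun W => (s W).1).
have Xx : X x.
  apply: X_subst_closed => N; have [l _ ?] := Hx N 0; exists (s l).1 => //.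
  by case: (Hs l).
have [_ _ /(_ x Xx 1) [m Hm] _] := pi_factor.
have [l ml sx] := Hx m m; have [X1 X2 s12 []] := Hs l.
rewrite (Hm _ X1 sx 0) // (Hm _ X2 _ 0) //.
by apply: agree_trans sx; apply: agree_sym; apply: agree_le ml.
Qed.

Variable W : nat.
Hypotheses (W_gt1 : 1 < W)
  (pi_window : forall x x', X x -> X x' -> agree W x x' -> pi x 0 = pi x' 0).

Definition level (n : nat) (v : nat -> A) : nat -> B := pi (phi_ n v).

Lemma X_subst_iter n v : X v -> X (phi_ n v).
Proof. by move=> Xv; elim: n => // n IH; apply: X_subst_subst_seq. Qed.

(** Windows of [phi^n(v)] starting before [k^n (N + 1)] end within the first [k^n (N + W)] letters,
    because [W - 1 <= k^n (W - 1)]. *)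
Lemma level_agree n N v w : X v -> X w -> agree (N + W) v w ->
  agree (k ^ n * N.+1) (level n v) (level n w).
Proof.
move=> Xv Xw vw i iN; rewrite -[i]add0n /level.
rewrite -2![pi _ _]/(shiftN i (pi _) 0) -!factor_map_shift; try exact: X_subst_iter.
apply: pi_window; try by apply/X_subst_shift/X_subst_iter.
move=> l lW; rewrite /shiftN.
apply: (@subst_seq_iter_agree _ k phi k_gt0 n _ _ _ vw).
have := @expk_gt0 k k_gt0 n; nia.
Qed.

Lemma level_shift n j v : X v ->
  level n (shiftN j v) = shiftN (k ^ n * j) (level n v).
Proof.
move=> Xv; rewrite /level subst_seq_iter_shift // factor_map_shift //.
exact: X_subst_iter.
Qed.

Lemma level_unfold n c m v : X v ->
  level n (unfold c m v) = shiftN (k ^ n * c) (level (n + m) v).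
Proof.
move=> Xv; rewrite level_shift; last exact: X_subst_iter.
by rewrite /level /subst_seq_iter -iterD.
Qed.

Lemma pi_unfold c m v : X v -> pi (unfold c m v) = shiftN c (level m v).
Proof. by move=> Xv; rewrite factor_map_shift //; apply: X_subst_iter. Qed.

Notation window := {ffun 'I_W -> A}.
Definition window_of (v : nat -> A) : window := [ffun i : 'I_W => v i].

Lemma window_of_eq v w : window_of v = window_of w <-> agree W v w.
Proof.
split=> [/ffunP vw i iW|vw]; first by have := vw (Ordinal iW); rewrite !ffunE.
by apply/ffunP => i; rewrite !ffunE vw.
Qed.

Lemma level_window n v w : X v -> X w -> window_of v = window_of w ->
  agree (k ^ n) (level n v) (level n w).
Proof.
by move=> Xv Xw /window_of_eq /(@level_agree n 0 v w Xv Xw); rewrite muln1.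
Qed.

(** The blocks grow with [n], but the relation of having equal blocks lives on pairs of windows, so
    it takes finitely many values over all [n]. *)
Definition same_block (n : nat) : {set window * window} :=
  [set p | `[< forall v w, X v -> X w -> window_of v = p.1 ->
    window_of w = p.2 -> agree (k ^ n) (level n v) (level n w) >]].

Lemma same_blockP n v w : X v -> X w ->
  reflect (agree (k ^ n) (level n v) (level n w))
    ((window_of v, window_of w) \in same_block n).
Proof.
move=> Xv Xw; rewrite inE; apply: (iffP (asboolP _)) => [|vw v' w' Xv' Xw' /= v'v w'w].
  exact.
apply: agree_trans (level_window Xv' Xv v'v) _.
by apply: agree_trans vw _; apply: level_window.
Qed.

(** Equality at level [n] thus depends on [n] only through [same_block n], which lets it pass from
    one level to another. *)
Lemma level_eqP n v w : X v -> X w ->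
  level n v = level n w <->
  forall j, (window_of (shiftN j v), window_of (shiftN j w)) \in same_block n.
Proof.
move=> Xv Xw; split=> [vw j|vw].
  by apply/same_blockP; try exact: X_subst_shift; rewrite !level_shift // vw.
apply: funext => i; rewrite (divn_eq i (k ^ n)) mulnC addnC.
have Xj z : X z -> X (shiftN (i %/ k ^ n) z) by apply: X_subst_shift.
have /same_blockP := vw (i %/ k ^ n) => /(_ (Xj _ Xv) (Xj _ Xw)).
rewrite !level_shift //; apply.
by rewrite ltn_pmod // expn_gt0 k_gt0.
Qed.

Lemma level_eq_same_block n n' v w : X v -> X w ->
  same_block n = same_block n' -> level n v = level n w -> level n' v = level n' w.
Proof. by move=> Xv Xw E /(level_eqP _ Xv Xw); rewrite E => /(level_eqP _ Xv Xw). Qed.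

(** * Types of points over an automatic sequence *)

Section Fiber.
Variables (y : nat -> B) (C : finType) (u : nat -> C).
Hypothesis y_blocks : forall n j j' i,
  i < k ^ n -> u j = u j' -> y (k ^ n * j + i) = y (k ^ n * j' + i).

(** Windows are taken from [j.+1] on because block 0 of [level n v] may begin before [y] does;
    [window_of v] controls that block. Keeping only the set of triples makes the type finite. *)
Definition itinerary (v : nat -> A) : {set C * C * window} :=
  [set p | `[< exists j, p = (u j, u j.+1, window_of (shiftN j.+1 v)) >]].

Definition type_of (n : nat) (v : nat -> A) :=
  (same_block n, window_of v, itinerary v).

(* For [j >= 1] the block of [level n v] at [j] is a block of [y] straddling the
   [k^n]-blocks of [y] at [j-1] and [j], so it only depends on [u_{j-1}], [u_j]. *)
Lemma type_of_level n m c v w :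
  X v -> X w -> c < k ^ n -> shiftN c (level n w) = y ->
  type_of m v = type_of n w -> level n v = level n w.
Proof.
move=> Xv Xw cn wy [_ vw It]; apply/level_eqP => // -[|j].
  apply/same_blockP; try exact: X_subst_shift.
  by rewrite !shiftN0; apply: level_window.
have : (u j, u j.+1, window_of (shiftN j.+1 v)) \in itinerary w.
  by rewrite -It inE; apply/asboolP; exists j.
rewrite inE => /asboolP [j' E]; case: E => u0 u1 ->.
apply/same_blockP; try exact: X_subst_shift.
have block l i : i < k ^ n -> level n (shiftN l.+1 w) i
    = if c <= i then y (k ^ n * l.+1 + (i - c)) else y (k ^ n * l + (k ^ n + i - c)).
  move=> ik; rewrite level_shift // -wy /shiftN.
  by case: leqP => ci; congr level; rewrite ?mulnS; lia.
move=> i ik; rewrite !block //; case: leqP => ci; apply: y_blocks => //; lia.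
Qed.

End Fiber.

(** * Quasi-fixed points in the fibers *)

Lemma factor_quasi_fixed_exists y : Y y -> automatic k y ->
  exists x, [/\ X x, quasi_fixed k phi x & pi x = y].
Proof.
move=> Yy /(automatic_blocks k_gt0) [C [u y_blocks]].
have [_ /(_ y Yy) [x Xx xy] _ _] := pi_factor.
have [v [d [chain_v v0]]] := X_subst_chain k_gt1 phi_k Xx.
have Xv n : X (v n) by case: (chain_v n).
have d_lt n : d n < k by case: (chain_v n).
have [t Ht] := infinite_pigeonhole (fun n => type_of u n (v n)).
have [a _ ta] := Ht 0; have [a' aa' ta'] := Ht a.+1; clear Ht.
set m := a' - a; have a'E : a' = a + m by rewrite subnKC // ltnW.
have m_gt0 : 0 < m by rewrite subn_gt0.
pose c0 := digits_value k d a.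
have y_level n : shiftN (digits_value k d n) (level n (v n)) = y.
  by rewrite -pi_unfold // -chain_unfold // v0.
have tE : type_of u a (v a) = type_of u a' (v a') := etrans ta (esym ta').
have Ea : same_block a' = same_block a by case: tE.
have vv : level a' (v a) = level a' (v a').
  by apply: (type_of_level y_blocks _ _ _ (y_level a') tE) => //; apply: digits_value_lt.
pose c := digits_value k (fun i => d (a + i)) m.
have c_lt : c < k ^ m by apply: digits_value_lt => // i; apply: d_lt.
have vaE : v a = unfold c m (v a').
  by have := chain_unfold k_gt1 m (chain_shift a chain_v); rewrite addn0 -a'E.
have [q [w [q_gt0 wE w_lim]]] := unfold_at_periodic_limit phi (v a) k_gt1 m_gt0 c_lt.
have X_iter i : X (iter i (unfold c m) (v a)).
  by elim: i => [|i IH]; [apply: Xv | rewrite iterS; apply: X_subst_unfold_at].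
(* With [S = unfold c m], [level a (S z)] is a shift of [level a' z]. Equality at level [a] lifts to
   level [a'] through [Ea], and [vv] with [v a = S (v a')] closes the loop. *)
have level_iter i : level a (iter i (unfold c m) (v a)) = level a (v a).
  elim: i => // i IH; rewrite iterS level_unfold // -a'E.
  rewrite (level_eq_same_block _ _ (esym Ea) IH) // vv.
  by rewrite [in RHS]vaE level_unfold // -a'E.
have Xw : X w.
  apply: X_subst_closed => N; have [i wi] := w_lim N.
  by exists (iter i (unfold c m) (v a)) => //; apply: agree_sym.
have level_w : level a w = level a (v a).
  apply: agree_eq => N; have [i wi] := w_lim (N + W); rewrite -(level_iter i).
  apply: agree_le (@level_agree a N _ _ Xw (X_iter i) wi) _.
  have := @expk_gt0 k k_gt0 a; nia.
have [c' c'E] := iter_unfold_at phi k_gt0 c m q w.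
exists (unfold c0 a w); split.
- exact: X_subst_unfold_at.
- apply: (@quasi_fixed_unfold_at _ k phi k_gt0 a c0 c' (m * q)).
    by rewrite muln_gt0 m_gt0.
  by rewrite -c'E.
- by rewrite pi_unfold // level_w; apply: y_level.
Qed.

Lemma shiftN_inj_nonperiodic (V z : nat -> B) a b :
  ~ periodic z -> shiftN a V = z -> shiftN b V = z -> a = b.
Proof.
move=> npz; wlog ab : a b / a < b.
  by move=> H az bz; case: (ltngtP a b) => // h; [apply: H|apply/esym/H].
move=> az bz; case: npz; exists (b - a); first by rewrite subn_gt0.
move=> n; rewrite -{1}az -bz /shiftN; congr V; lia.
Qed.

(* All points [T^{c_e}(phi^e(v_{a0}))] lie in the fiber when [e] has the type of
   [a0]; two of them must share their type at infinitely many levels, and then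
   nonperiodicity forces them to have the same offsets. *)
Lemma fiber_quasi_fixed y x : automatic k y -> ~ periodic y ->
  X x -> pi x = y -> quasi_fixed k phi x.
Proof.
move=> /(automatic_blocks k_gt0) [C [u y_blocks]] npy Xx xy.
have [v [d [chain_v v0]]] := X_subst_chain k_gt1 phi_k Xx.
have Xv n : X (v n) by case: (chain_v n).
have d_lt n : d n < k by case: (chain_v n).
pose off a m := digits_value k (fun i => d (a + i)) m.
have off_lt a m : off a m < k ^ m by apply: digits_value_lt => // i.
have offD a m m' : off a (m + m') = off a m + k ^ m * off (a + m) m'.
  rewrite /off digits_valueD //; congr (_ + _ * digits_value k _ _).
  by apply: funext => i; rewrite addnA.
have vE a m : v a = unfold (off a m) m (v (a + m)).
  by rewrite -[a in LHS]addn0; exact: chain_unfold (chain_shift a chain_v).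
have y_level n : shiftN (off 0 n) (level n (v n)) = y.
  by rewrite -pi_unfold // -[n in v n]add0n -vE v0.
have [t /infinite_enumeration [e [te e_lt]]] :=
  infinite_pigeonhole (fun n => type_of u n (v n)).
set a0 := e 0.
(* Having the type of [v (e i)], the point [v a0] replaces it over [y] at level [e i]; it is then
   desubstituted [m] more times. *)
have y_level0 i m :
    shiftN (off 0 (e i) + k ^ e i * off a0 m) (level (e i + m) (v (a0 + m))) = y.
  rewrite -shiftN_add -level_unfold // -vE.
  have tE : type_of u a0 (v a0) = type_of u (e i) (v (e i)) by rewrite !te.
  by rewrite (type_of_level y_blocks _ _ (off_lt 0 (e i)) (y_level (e i)) tE).
(* Both points lie over [y] at level [n], reached from levels [e i] and [e j]. Truncated subtraction
   is harmless, as [n >= e j] is chosen below. *)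
have [i [j [ij Hij]]] :=
  pair_pigeonhole (fun i n => type_of u n (v (a0 + (n - e i)))).
set q := e j - e i; have q_gt0 : 0 < q by rewrite subn_gt0 e_lt.
have ejE : e j = e i + q by rewrite subnKC // ltnW ?e_lt.
have off_lt0 l m : off 0 (e l) + k ^ e l * off a0 m < k ^ (e l + m).
  by rewrite expnD; have := off_lt 0 (e l); have := off_lt a0 m; nia.
have v_eq : v a0 = v (a0 + q).
  apply: agree_eq => N; have [n Nn tn] := Hij (N + e j).
  pose m := n - e j.
  have niE : n - e i = q + m by rewrite /m /q; have := e_lt _ _ ij; lia.
  rewrite -/m niE in tn.
  have njE : n = e j + m by rewrite /m; lia.
  have yi := y_level0 i (q + m); have yj := y_level0 j m.
  rewrite addnA -ejE -njE in yi; rewrite -njE in yj.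
  have lev := type_of_level y_blocks _ _ _ yj tn.
  rewrite lev // in yi; last by rewrite [in ltnRHS]njE off_lt0.
  have := shiftN_inj_nonperiodic npy yi yj.
  rewrite offD mulnDr addnA mulnA -expnD -ejE => E.
  (* Both sides of [E] are split at [k^(e j)]; the low parts are below it, so the quotients
     agree. *)
  have offE : off (a0 + q) m = off a0 m.
    have lt1 : off 0 (e i) + k ^ e i * off a0 q < k ^ e j by rewrite ejE off_lt0.
    have := congr1 (divn^~ (k ^ e j)) E.
    rewrite !(addnC _ (k ^ e j * _)) !(mulnC (k ^ e j)) !divnMDl ?expk_gt0 //.
    by rewrite !divn_small // !addn0.
  have /window_of_eq win : window_of (v (a0 + q + m)) = window_of (v (a0 + m)).
    by rewrite -addnA; case: tn.
  (* With equal offsets [c] and equal windows after [m] steps, the two points agree on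
     [k^m W - c >= k^m > m >= N] letters. *)
  rewrite (vE a0 m) (vE (a0 + q) m) offE.
  have := @unfold_at_agree _ k phi k_gt0 (off a0 m) m _ _ _ (agree_sym win).
  move/agree_le; apply.
  have : m < k ^ m by apply: ltn_expl.
  have Nm : N <= m by rewrite /m; lia.
  have := off_lt a0 m; have : k ^ m * 2 <= k ^ m * W by rewrite leq_mul2l W_gt1 orbT.
  lia.
(* Now [v a0] is fixed by some [T^c o phi^q], and [x] is an unfolding of it. *)
rewrite -v0 (vE 0 a0); apply: (@quasi_fixed_unfold_at _ k phi k_gt0 _ _ (off a0 q) q) => //.
by rewrite [in RHS](vE a0 q) add0n -v_eq.
Qed.

End Factor.

Theorem theorem4p2 (A B : finType) (k : nat) (phi : A -> seq A)
  (Y : (nat -> B) -> Prop) (pi : (nat -> A) -> (nat -> B)) :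
  2 <= k ->
  const_length k phi ->
  subshift Y ->
  factor_map (X_subst phi) Y pi ->
  (forall y, Y y ->
     automatic k y <->
     exists x, [/\ X_subst phi x, quasi_fixed k phi x & pi x = y])
  /\
  (forall y, Y y -> automatic k y -> ~ periodic y ->
     forall x, X_subst phi x -> pi x = y -> quasi_fixed k phi x).
Proof.
move=> k_gt1 phi_k _ pi_factor.
have [W [W_gt1 pi_window]] := factor_map_window pi_factor.
split=> [y Yy|y _ y_aut npy x Xx xy]; last first.
  exact: (fiber_quasi_fixed k_gt1 phi_k pi_factor W_gt1 pi_window y_aut npy Xx xy).
split=> [y_aut|[x [Xx qx <-]]].
  exact: (factor_quasi_fixed_exists k_gt1 phi_k pi_factor W_gt1 pi_window Yy y_aut).
(* [pi x] is a sliding block code of [x]: its letter at [n] is letter 0 of [pi (T^n x)]. *)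
apply: (automatic_of_quasi_fixed k_gt1 qx (W := W)) => n n' nn'.
have := pi_window _ _ (X_subst_shift n Xx) (X_subst_shift n' Xx) nn'.
by rewrite !(factor_map_shift pi_factor).
Qed.
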